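(* For each $n \in \{94, 95, 96\}$ there exists a 4-regular matchstick graph with exactly $n$ vertices.
   Context: A matchstick graph is a finite graph drawn in the Euclidean plane such that vertices are distinct points, every edge is a straight line segment of length 1 between its endpoints, and edges do not cross or overlap (two edges intersect at most in a common endpoint). A matchstick graph is 4-regular if every vertex has degree exactly 4. *)

(* Defs.v *)
From Stdlib Require Import Reals.
From mathcomp Require Import all_boot.

Set Implicit Arguments.
Unset Strict Implicit.
Unset Printing Implicit Defensive.

Local Open Scope R_scope.

Definition point := (R * R)%type.

Definition sqdist (p q : point) : R :=
  ((fst p - fst q) * (fst p - fst q) + (snd p - snd q) * (snd p - snd q)).

Definition seg_pt (p q : point) (s : R) : point :=
  (((1 - s) * fst p + s * fst q), ((1 - s) * snd p + s * snd q)).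

Definition on_segment (x p q : point) : Prop :=
  exists s : R, (0 <= s <= 1) /\ x = seg_pt p q s.

Definition matchstick_graph (n : nat) (e : rel 'I_n) (pos : 'I_n -> point)
  : Prop :=
  [/\ (forall i, ~~ e i i),
      (forall i j, e i j = e j i),
      injective pos,
      (forall i j, e i j -> sqdist (pos i) (pos j) = 1) &
      (forall a b c d, e a b -> e c d ->
         ~ ((a = c /\ b = d) \/ (a = d /\ b = c)) ->
         forall x : point,
           on_segment x (pos a) (pos b) -> on_segment x (pos c) (pos d) ->
           exists v, (v = a \/ v = b) /\ (v = c \/ v = d) /\ x = pos v)].

Definition four_regular (n : nat) (e : rel 'I_n) : Prop :=
  forall i : 'I_n, #|[set j | e i j]| = 4%N.

(* Main.v *)
(** Glue equilateral triangles of side 2, subdivided by their midpoints, to the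
    legs of a triangle with sides 1, 2, 2, and an equilateral unit triangle to
    its base.  In this kite all 12 vertices have degree 4 except the three
    outer apexes, which have degree 2.  A kite and its mirror image in the line
    through two of these apexes form a brace: 22 vertices, all of degree 4
    except two ends of degree 2, at distance L with L^2 = (687 + 279 sqrt 5)/38.
    Two braces meeting at a new joint span any two points that are not too far
    apart, adding 41 vertices.  So it suffices to span by two such pairs of
    braces the four vertices of degree 2 of cores with 12, 13 and 14 vertices
    whose other vertices have degree 4: two strips of 3 and 5 triangles whose
    short sides are linked by two edges; a kite in which one edge at the apex of
    the 1, 2, 2 triangle is opened into a rhombus; two linked strips of 5
    triangles.  All coordinates lie in towers of real quadratic extensions,
    where unit lengths are checked exactly, while disjointness of edges follows
    from separating lines for approximations by lattice points. *)

Require Import Defs.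
From Stdlib Require Import Reals ZArith Lia Lra.
From mathcomp Require Import all_boot.

Set Implicit Arguments.
Unset Strict Implicit.
Unset Printing Implicit Defensive.

Local Open Scope R_scope.

(** * Exact arithmetic in towers of real quadratic extensions *)

(* [encl x = (m, r)] encloses [scale * value x] in [[m - r, m + r]], and
   [is_int x z] is a sufficient test for [value x = z]. *)
Record numRing := NumRing {
  elt : Type;
  inj : Z -> elt;
  add : elt -> elt -> elt;
  opp : elt -> elt;
  mul : elt -> elt -> elt;
  is_int : elt -> Z -> bool;
  scale : Z;
  encl : elt -> Z * Z;
  value : elt -> R;
  value_inj : forall z, value (inj z) = IZR z;
  value_add : forall x y, value (add x y) = value x + value y;
  value_opp : forall x, value (opp x) = - value x;
  value_mul : forall x y, value (mul x y) = value x * value y;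
  value_is_int : forall x z, is_int x z = true -> value x = IZR z;
  scale_gt0 : (0 < scale)%Z;
  enclP : forall x,
    Rabs (IZR scale * value x - IZR (encl x).1) <= IZR (encl x).2 }.

Arguments inj : clear implicits.

Lemma is_intZ (x z : Z) : Z.eqb x z = true -> IZR x = IZR z.
Proof. by move/Z.eqb_eq => ->. Qed.

Lemma enclZ (x : Z) : Rabs (IZR 1 * IZR x - IZR (x, 0%Z).1) <= IZR (x, 0%Z).2.
Proof. by rewrite /= Rmult_1_l Rminus_diag Rabs_R0; lra. Qed.

Definition intRing : numRing :=
  @NumRing Z id Z.add Z.opp Z.mul Z.eqb 1%Z (fun x => (x, 0%Z)) IZR
    (fun=> erefl) plus_IZR opp_IZR mult_IZR is_intZ erefl enclZ.

Local Arguments Z.mul : simpl never.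

Definition root_test (A : numRing) (c : elt A) (prec m : Z) : bool :=
  let: (mc, ec) := encl c in
  [&& (0 <? prec)%Z, (1 <=? m)%Z, ((m - 1) * (m - 1) * scale A <=? prec * prec * (mc - ec))%Z
    & (prec * prec * (mc + ec) <=? (m + 1) * (m + 1) * scale A)%Z].

Lemma Rabs_le_inv (x a : R) : Rabs x <= a -> - a <= x <= a.
Proof. by move=> H; split; move: H; rewrite /Rabs; case: Rcase_abs; lra. Qed.

(** As [m >= 1], the lower inequality of the test makes the radicand nonnegative; monotonicity of
    squaring then bounds the root on both sides. *)
Lemma root_testP (A : numRing) (c : elt A) (prec m : Z) :
  root_test c prec m = true ->
  [/\ (0 < prec)%Z, 0 <= value c, 1 <= IZR m &
    Rabs (IZR prec * sqrt (value c) - IZR m) <= 1].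
Proof.
rewrite /root_test; have := enclP c; have := scale_gt0 A.
case: (encl c) => mc ec /= /IZR_lt sA /Rabs_le_inv.
move: sA; set s := IZR (scale A); set v := value c => s0 [h1 h2].
case/and4P => /Z.ltb_lt prec0 /Z.leb_le/IZR_le H0.
move=> /Z.leb_le/IZR_le H1 /Z.leb_le/IZR_le H2.
have P0 := IZR_lt _ _ prec0.
move: H1 H2; rewrite !mult_IZR !minus_IZR !plus_IZR -/s.
move: P0 H0; set p := IZR prec; set k := IZR m => P0 H0 H1 H2.
have pp := Rmult_lt_0_compat _ _ P0 P0.
have {}H1 : (k - 1) * (k - 1) <= p * p * v.
  apply: (Rmult_le_reg_r _ _ _ s0); apply: (Rle_trans _ _ _ H1).
  have -> : p * p * v * s = p * p * (s * v) by ring.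
  by apply: Rmult_le_compat_l; lra.
have {}H2 : p * p * v <= (k + 1) * (k + 1).
  apply: (Rmult_le_reg_r _ _ _ s0); apply: (Rle_trans _ _ _ _ H2).
  have -> : p * p * v * s = p * p * (s * v) by ring.
  by apply: Rmult_le_compat_l; lra.
have v0 : 0 <= v by case: (Rle_lt_dec 0 v) => //; nra.
split=> //; have := sqrt_pos v; have := sqrt_sqrt _ v0.
move: (sqrt v) => r rr r0; apply: Rabs_le.
have t0 : 0 <= p * r by nra.
have tt : (p * r) * (p * r) = p * p * v by rewrite -rr; ring.
by rewrite -tt in H1 H2; split; nra.
Qed.

Section Quad.
Variables (A : numRing) (c : elt A) (prec m : Z) (cm : root_test c prec m = true).

(* The pair [(a, b)] stands for [a + b * sqrt c]. *)
Definition qelt : Type := (elt A * elt A)%type.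
Definition qadd (x y : qelt) : qelt := (add x.1 y.1, add x.2 y.2).
Definition qopp (x : qelt) : qelt := (opp x.1, opp x.2).
Definition qmul (x y : qelt) : qelt :=
  (add (mul x.1 y.1) (mul c (mul x.2 y.2)),
   add (mul x.1 y.2) (mul x.2 y.1)).
Definition qis_int (x : qelt) (z : Z) : bool := is_int x.1 z && is_int x.2 0.
Definition qencl (x : qelt) : Z * Z :=
  let: (m1, r1) := encl x.1 in let: (m2, r2) := encl x.2 in
  (prec * m1 + m * m2, prec * r1 + (m + 1) * r2 + Z.abs m2)%Z.
Definition qval (x : qelt) : R := value x.1 + value x.2 * sqrt (value c).

Lemma qval_inj z : qval (inj A z, inj A 0) = IZR z.
Proof. by rewrite /qval /= !value_inj Rmult_0_l Rplus_0_r. Qed.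

Lemma qval_add x y : qval (qadd x y) = qval x + qval y.
Proof. by rewrite /qval !value_add; ring. Qed.

Lemma qval_opp x : qval (qopp x) = - qval x.
Proof. by rewrite /qval !value_opp; ring. Qed.

Lemma qval_mul x y : qval (qmul x y) = qval x * qval y.
Proof.
have [_ c0 _ _] := root_testP cm.
rewrite /qval /= !value_add !value_mul -{1}(sqrt_sqrt _ c0); ring.
Qed.

Lemma qval_is_int x z : qis_int x z = true -> qval x = IZR z.
Proof.
by case/andP => h1 h2; rewrite /qval (value_is_int h1) (value_is_int h2); ring.
Qed.

Lemma qscale_gt0 : (0 < prec * scale A)%Z.
Proof. by have [+ _ _ _] := root_testP cm; have := scale_gt0 A; lia. Qed.

Lemma qenclP x : Rabs (IZR (prec * scale A) * qval x - IZR (qencl x).1)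
  <= IZR (qencl x).2.
Proof.
have [prec0 _ k_ge1] := root_testP cm; rewrite /qval /qencl.
have := enclP x.1; have := enclP x.2.
case: (encl x.1) => m1 r1; case: (encl x.2) => m2 r2 /=.
move: k_ge1; rewrite !plus_IZR !mult_IZR !plus_IZR abs_IZR.
move: (IZR (scale A)) (value x.1) (value x.2) (sqrt _) => s v1 v2 r k1 H2 H1 Hr.
have P0 := IZR_lt _ _ prec0.
move: (IZR prec) (IZR m1) (IZR m2) (IZR m) (IZR r1) (IZR r2) P0 k1 H1 H2 Hr.
move=> p a b k e1 e2 P0 k1 H1 H2 Hr.
(* The three summands match the three terms of the radius in [qencl]; the factor [p * r] is at most
   [k + 1]. *)
have -> : p * s * (v1 + v2 * r) - (p * a + k * b) =
  p * (s * v1 - a) + (s * v2 - b) * (p * r) + b * (p * r - k) by ring.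
apply: Rle_trans (Rabs_triang _ _) _; apply: Rplus_le_compat.
  apply: Rle_trans (Rabs_triang _ _) _; apply: Rplus_le_compat.
    by rewrite Rabs_mult (Rabs_pos_eq p); nra.
  rewrite Rabs_mult Rmult_comm; apply: Rmult_le_compat => //; try exact: Rabs_pos.
  have -> : p * r = k + (p * r - k) by ring.
  by apply: Rle_trans (Rabs_triang _ _) _; rewrite (Rabs_pos_eq k); lra.
rewrite Rabs_mult -{2}[Rabs b]Rmult_1_r; apply: Rmult_le_compat_l => //.
exact: Rabs_pos.
Qed.

Definition quadRing : numRing :=
  @NumRing qelt (fun z => (inj A z, inj A 0)) qadd qopp qmul qis_int
    (prec * scale A) qencl qval qval_inj qval_add qval_opp qval_mul qval_is_int
    qscale_gt0 qenclP.

End Quad.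

(** * Certifying a drawing *)

Lemma on_segmentC x p q : on_segment x p q -> on_segment x q p.
Proof.
case=> s [s01 ->]; exists (1 - s); split; first by lra.
by rewrite /seg_pt; congr pair; ring.
Qed.

(** Both parameters of [x] equal its distance from [p], so they agree; a nonzero common value would
    force [q = r]. *)
Lemma unit_segments_common_end x p q r :
  sqdist p q = 1 -> sqdist p r = 1 -> q <> r ->
  on_segment x p q -> on_segment x p r -> x = p.
Proof.
case: p q r => [p1 p2] [q1 q2] [r1 r2]; rewrite /sqdist /= => pq pr qr.
case=> s [s01 ->] [t [t01]]; rewrite /seg_pt /= => -[e1 e2].
have {}e1 : s * (p1 - q1) = t * (p1 - r1) by lra.
have {}e2 : s * (p2 - q2) = t * (p2 - r2) by lra.
have st : s * s = t * t.
  rewrite -[s * s]Rmult_1_r -[t * t]Rmult_1_r -{1}pq -pr.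
  have -> u a b : u * u * (a * a + b * b) = u * a * (u * a) + u * b * (u * b).
    by ring.
  by rewrite e1 e2; ring.
have {}st : s = t by apply: Rsqr_inj; rewrite /Rsqr //; lra.
case: (Req_dec s 0) => [-> | s0]; first by congr pair; ring.
rewrite -st in e1 e2.
have {}e1 := Rmult_eq_reg_l _ _ _ e1 s0.
have {}e2 := Rmult_eq_reg_l _ _ _ e2 s0.
by case: qr; congr pair; lra.
Qed.

Definition grid : Z := 1000.

(** The tolerance 2 leaves room for the rounding down in [grid_point] and for the radius of the
    enclosure. *)
Definition near (p : point) (a : Z * Z) : Prop :=
  Rabs (IZR grid * p.1 - IZR a.1) <= 2 /\ Rabs (IZR grid * p.2 - IZR a.2) <= 2.

Definition dotZ (n a : Z * Z) : Z := (n.1 * a.1 + n.2 * a.2)%Z.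

(** Approximation shifts a product with [n] by at most [2 * (|n.1| + |n.2|)]; the margin [g] allows
    for this on both sides. *)
Definition below (n a b c d : Z * Z) : bool :=
  let g := (4 * (Z.abs n.1 + Z.abs n.2))%Z in
  let u := (Z.max (dotZ n a) (dotZ n b) + g)%Z in
  (u <? dotZ n c)%Z && (u <? dotZ n d)%Z.

(* Two disjoint segments [a, b] and [c, d] are always separated by a line
   parallel to one of them or, when they are collinear, perpendicular to both;
   the two coordinate directions come first only because they are cheap. *)
Definition separated (a b c d : Z * Z) : bool :=
  let test n := below n a b c d || below n c d a b in
  if test (1, 0)%Z || test (0, 1)%Z then true else
  [|| test (b.2 - a.2, a.1 - b.1)%Z, test (d.2 - c.2, c.1 - d.1)%Z
    | test (b.1 - a.1, b.2 - a.2)%Z].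

Lemma dotZ_near (n a : Z * Z) (p : point) : near p a ->
  Rabs (IZR grid * (IZR n.1 * p.1 + IZR n.2 * p.2) - IZR (dotZ n a)) <=
  2 * (Rabs (IZR n.1) + Rabs (IZR n.2)).
Proof.
case=> h1 h2; rewrite /dotZ plus_IZR !mult_IZR.
have -> : IZR grid * (IZR n.1 * p.1 + IZR n.2 * p.2) -
    (IZR n.1 * IZR a.1 + IZR n.2 * IZR a.2) =
  IZR n.1 * (IZR grid * p.1 - IZR a.1) + IZR n.2 * (IZR grid * p.2 - IZR a.2).
  by ring.
apply: Rle_trans (Rabs_triang _ _) _; rewrite !Rabs_mult.
have n1 := Rabs_pos (IZR n.1); have n2 := Rabs_pos (IZR n.2).
have := Rmult_le_compat_l _ _ _ n1 h1; have := Rmult_le_compat_l _ _ _ n2 h2; lra.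
Qed.

Lemma belowP n a b c d p q r s x : near p a -> near q b -> near r c ->
  near s d -> below n a b c d = true ->
  on_segment x p q -> on_segment x r s -> False.
Proof.
move=> /(dotZ_near n)/Rabs_le_inv pa /(dotZ_near n)/Rabs_le_inv qb.
move=> /(dotZ_near n)/Rabs_le_inv rc /(dotZ_near n)/Rabs_le_inv sd.
case/andP; move: (dotZ n a) (dotZ n b) (dotZ n c) (dotZ n d) pa qb rc sd.
move=> A B C D pa qb rc sd /Z.ltb_lt h1 /Z.ltb_lt h2.
have {h1 h2} : [/\ A + 4 * (Z.abs n.1 + Z.abs n.2) < C,
    B + 4 * (Z.abs n.1 + Z.abs n.2) < C, A + 4 * (Z.abs n.1 + Z.abs n.2) < D &
    B + 4 * (Z.abs n.1 + Z.abs n.2) < D]%Z by split; lia.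
case=> /IZR_lt + /IZR_lt + /IZR_lt + /IZR_lt.
rewrite !plus_IZR !mult_IZR !plus_IZR !abs_IZR => h1 h2 h3 h4.
case=> u [u01 ->] [v [v01]]; rewrite /seg_pt => -[e1 e2].
have P0 : 0 < IZR grid by apply: IZR_lt.
move: pa qb rc sd h1 h2 h3 h4 e1 e2.
set k := IZR grid; move: (Rabs _ + Rabs _) => g.
move: (IZR A) (IZR B) (IZR C) (IZR D) => {}A {}B {}C {}D pa qb rc sd h1 h2 h3 h4 e1 e2.
set fp := k * _ in pa; set fq := k * _ in qb.
set fr := k * _ in rc; set fs := k * _ in sd.
have e : (1 - u) * fp + u * fq = (1 - v) * fr + v * fs.
  transitivity (k * (IZR n.1 * ((1 - u) * fst p + u * fst q) +
    IZR n.2 * ((1 - u) * snd p + u * snd q))); first by rewrite /fp /fq; ring.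
  by rewrite e1 e2 /fr /fs; ring.
have [m [fpm fqm mr ms]] : exists m, [/\ fp <= m, fq <= m, m < fr & m < fs].
  by exists (Rmax fp fq); split; rewrite /Rmax; case: Rle_dec; lra.
clearbody fp fq fr fs.
have : (1 - u) * fp + u * fq <= m by nra.
suff : m < (1 - v) * fr + v * fs by lra.
(* The larger of the two weights is positive, which keeps the inequality strict. *)
by case: (Rle_lt_dec v (1 / 2)) => ?; nra.
Qed.

Lemma separatedP a b c d p q r s x : near p a -> near q b -> near r c ->
  near s d -> separated a b c d = true ->
  on_segment x p q -> on_segment x r s -> False.
Proof.
move=> pa qb rc sd h xpq xrs.
have test n : below n a b c d || below n c d a b -> False.
  case/orP => {}h; first exact: (belowP pa qb rc sd h xpq xrs).
  exact: (belowP rc sd pa qb h xrs xpq).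
move: h; rewrite /separated; case: ifP => [/orP[] /test // | _].
by case/or3P; exact: test.
Qed.

Definition neighbours (E : seq (nat * nat)) (i : nat) : seq nat :=
  [seq e.2 | e <- E & e.1 == i] ++ [seq e.1 | e <- E & e.2 == i].

Lemma mem_neighbours E i j :
  (j \in neighbours E i) = ((i, j) \in E) || ((j, i) \in E).
Proof.
rewrite mem_cat; congr orb; apply/mapP/idP.
- by case=> -[a b] /=; rewrite mem_filter /= => /andP[/eqP -> ?] ->.
- by move=> ijE; exists (i, j); rewrite // mem_filter /= eqxx.
- by case=> -[a b] /=; rewrite mem_filter /= => /andP[/eqP -> ?] ->.
- by move=> ijE; exists (j, i); rewrite // mem_filter /= eqxx.
Qed.

(** [uniq] excludes edges listed twice, in the same or in opposite directions, so that the size is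
    the degree. *)
Definition regular_test (n : nat) (E : seq (nat * nat)) : bool :=
  all (fun i => uniq (neighbours E i) && (size (neighbours E i) == 4%N))
    (iota 0 n).

Definition range_test (n : nat) (E : seq (nat * nat)) : bool :=
  all (fun e => (e.1 < n)%N && (e.2 < n)%N) E.

Lemma regular_testP n E (e := fun i j : 'I_n => val j \in neighbours E (val i)) :
  range_test n E = true -> regular_test n E = true -> four_regular e.
Proof.
move=> /allP rE /allP h i.
have /h/andP[u /eqP <-] : val i \in iota 0 n by rewrite mem_iota ltn_ord.
have lt_n j : j \in neighbours E i -> (j < n)%N.
  by rewrite mem_neighbours => /orP[] /rE /andP[].
rewrite cardsE cardE -(size_map val); apply: perm_size.
apply: uniq_perm => //; first by rewrite map_inj_uniq ?enum_uniq //; exact: val_inj.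
move=> j; apply/mapP/idP => [[k + ->] | jN].
  by rewrite mem_enum.
by exists (Ordinal (lt_n j jN)) => //; rewrite mem_enum.
Qed.

Section Drawing.
Variables (K : numRing) (M : Z).

Definition cpx : Type := (elt K * elt K)%type.
Definition cadd (p q : cpx) : cpx := (add p.1 q.1, add p.2 q.2).
Definition csub (p q : cpx) : cpx := (add p.1 (opp q.1), add p.2 (opp q.2)).
Definition cmul (p q : cpx) : cpx :=
  (add (mul p.1 q.1) (opp (mul p.2 q.2)), add (mul p.1 q.2) (mul p.2 q.1)).
Definition cnorm2 (p : cpx) : elt K := add (mul p.1 p.1) (mul p.2 p.2).

Definition scaled (p : cpx) : point := (value p.1 / IZR M, value p.2 / IZR M).

Definition near_test1 (x : elt K) (a : Z) : bool :=
  let: (m, r) := encl x in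
  (Z.abs (grid * m - a * (scale K * M)) + grid * r <=? 2 * (scale K * M))%Z.

Definition near_test (p : cpx) (a : Z * Z) : bool :=
  near_test1 p.1 a.1 && near_test1 p.2 a.2.

Hypothesis M0 : (0 < M)%Z.

Lemma near_test1P x a : near_test1 x a = true ->
  Rabs (IZR grid * (value x / IZR M) - IZR a) <= 2.
Proof.
rewrite /near_test1; have := enclP x; case: (encl x) => m r /= h /Z.leb_le/IZR_le.
rewrite plus_IZR abs_IZR minus_IZR !mult_IZR; move: h.
have s0 := IZR_lt _ _ (scale_gt0 K); have k0 := IZR_lt _ _ M0.
have g0 : 0 < IZR grid by apply: IZR_lt.
move: (IZR (scale K)) (IZR M) (IZR grid) s0 k0 g0 => s k g s0 k0 g0.
move: (value x) (IZR m) (IZR r) (IZR a) => v c e b h1 h2.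
have sk : 0 < s * k by nra.
apply: (Rmult_le_reg_l _ _ _ sk).
rewrite -{1}(Rabs_pos_eq (s * k)); last by lra.
rewrite -Rabs_mult.
have -> : s * k * (g * (v / k) - b) = (g * c - b * (s * k)) + g * (s * v - c).
  by field; lra.
apply: Rle_trans (Rabs_triang _ _) _.
by rewrite (Rabs_mult g) (Rabs_pos_eq g); nra.
Qed.

Lemma near_testP p a : near_test p a = true -> near (scaled p) a.
Proof. by case/andP => /near_test1P h1 /near_test1P h2; split. Qed.

Lemma sqdist_scaled p q : is_int (cnorm2 (csub p q)) (M * M) = true ->
  sqdist (scaled p) (scaled q) = 1.
Proof.
move/value_is_int; rewrite value_add !value_mul !value_add !value_opp mult_IZR => h.
have k0 := IZR_lt _ _ M0; rewrite /sqdist /=.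
transitivity (((value p.1 + - value q.1) * (value p.1 + - value q.1) +
  (value p.2 + - value q.2) * (value p.2 + - value q.2)) / (IZR M * IZR M)).
  by field; lra.
by rewrite h; field; lra.
Qed.

Variables (n : nat) (P : seq cpx) (V : seq (Z * Z)) (E : seq (nat * nat)).

Definition vertex (i : nat) : cpx := nth (inj K 0, inj K 0) P i.
Definition approx (i : nat) : Z * Z := nth (0, 0)%Z V i.

Definition unit_test : bool :=
  all (fun e => is_int (cnorm2 (csub (vertex e.1) (vertex e.2))) (M * M)) E.

Definition approx_test : bool :=
  all (fun i => near_test (vertex i) (approx i)) (iota 0 n).

(** Vertices are treated as degenerate segments, for which only the two coordinate directions can
    succeed. *)
Definition injective_test : bool :=
  all (fun i => all (fun j =>
    separated (approx i) (approx i) (approx j) (approx j) || (i == j))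
    (iota 0 n)) (iota 0 n).

(** Edges with a common end are left to [unit_segments_common_end]. *)
Definition noncrossing_test : bool :=
  all (fun e => all (fun f =>
    separated (approx e.1) (approx e.2) (approx f.1) (approx f.2) ||
    [|| e.1 == f.1, e.1 == f.2, e.2 == f.1 | e.2 == f.2]) E) E.

Lemma matchstick_drawing :
  range_test n E = true -> regular_test n E = true -> unit_test = true ->
  approx_test = true -> injective_test = true -> noncrossing_test = true ->
  exists (e : rel 'I_n) (pos : 'I_n -> point),
    matchstick_graph e pos /\ four_regular e.
Proof.
move=> rE reg /allP uE /allP aV /allP injV /allP ncE.
pose e := fun i j : 'I_n => val j \in neighbours E (val i).
pose pos := fun i : 'I_n => scaled (vertex i).
exists e, pos; split; last exact: regular_testP.
have io (i : 'I_n) : val i \in iota 0 n by rewrite mem_iota ltn_ord.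
have nearV i : near (pos i) (approx i) by exact: near_testP (aV _ (io i)).
have end_segment (p : point) : on_segment p p p.
  by exists 0; split; [lra | case: p => a b; rewrite /seg_pt /=; congr pair; ring].
have pos_inj : injective pos.
  move=> i j ij; apply/val_inj/eqP.
  have /allP/(_ _ (io j))/orP[sij | //] := injV _ (io i).
  case: (separatedP (nearV i) (nearV i) (nearV j) (nearV j) sij (end_segment _)).
  by rewrite ij; exact: end_segment.
have unitE (i j : 'I_n) : e i j -> sqdist (pos i) (pos j) = 1.
  have sqdistC p q : sqdist p q = sqdist q p by rewrite /sqdist; ring.
  rewrite /e mem_neighbours => /orP[] /uE /(sqdist_scaled) h; first exact: h.
  by rewrite sqdistC; exact: h.
have eC i j : e i j = e j i by rewrite /e !mem_neighbours orbC.
split=> //.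
  move=> i; apply/negP => /unitE; rewrite /sqdist; lra.
move=> a b c d ab cd abcd x xab xcd.
have common (u v w : 'I_n) : e u v -> e u w -> v != w ->
    on_segment x (pos u) (pos v) -> on_segment x (pos u) (pos w) -> x = pos u.
  move=> /unitE uv /unitE uw /eqP vw.
  by apply: unit_segments_common_end => // /pos_inj.
case: (eqVneq a c) => [ac | ac].
  subst c; exists a; split; [by left | split; [by left |]].
  by apply: (common a b d) => //; apply/eqP => bd; apply: abcd; left.
case: (eqVneq a d) => [ad | ad].
  subst d; exists a; split; [by left | split; [by right |]].
  apply: (common a b c) => //; [by rewrite eC | | exact: on_segmentC].
  by apply/eqP => bc; apply: abcd; right.
case: (eqVneq b c) => [bc | bc].
  subst c; exists b; split; [by right | split; [by left |]].
  apply: (common b a d) => //; [by rewrite eC | exact: on_segmentC].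
case: (eqVneq b d) => [bd | bd].
  subst d; exists b; split; [by right | split; [by right |]].
  by apply: (common b a c) => //; [rewrite eC | rewrite eC | |]; try exact: on_segmentC.
have apart (i j k l : 'I_n) : i != k -> i != l -> j != k -> j != l ->
    (val i, val j) \in E -> (val k, val l) \in E ->
    on_segment x (pos i) (pos j) -> on_segment x (pos k) (pos l) -> False.
  move=> ik il jk jl /ncE/allP ijE /ijE.
  rewrite !val_eqE (negPf ik) (negPf il) (negPf jk) (negPf jl) !orbF.
  exact: separatedP.
have := ab; have := cd; rewrite /e !mem_neighbours.
(* [E] may list each of the two edges in either direction. *)
case/orP => cdE /orP[] abE; exfalso.
- exact: (apart a b c d).
- exact: (apart b a c d _ _ _ _ abE cdE (on_segmentC xab) xcd).
- exact: (apart a b d c _ _ _ _ abE cdE xab (on_segmentC xcd)).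
- exact: (apart b a d c _ _ _ _ abE cdE (on_segmentC xab) (on_segmentC xcd)).
Qed.
End Drawing.

(** * Kites, braces and cores *)

Local Close Scope R_scope.

Lemma root5 : root_test (5%Z : elt intRing) (10 ^ 16) 22360679774997896 = true.
Proof. by vm_compute. Qed.
Definition Q5 : numRing := quadRing root5.

Lemma root3 : root_test ((3, 0)%Z : elt Q5) (10 ^ 16) 17320508075688772 = true.
Proof. by vm_compute. Qed.
Definition Q53 : numRing := quadRing root3.

Definition ofQ5 (a b : Z) : elt Q53 := ((a, b), (0, 0))%Z.

Section Graph.
Variables (c1 : elt Q53) (p1 m1 : Z) (H1 : root_test c1 p1 m1 = true).
Let K1 : numRing := quadRing H1.
Variables (c2 : elt K1) (p2 m2 : Z) (H2 : root_test c2 p2 m2 = true).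
Let K : numRing := quadRing H2.

Definition sigma1 : elt K := ((inj Q53 0, inj Q53 1), inj K1 0).
Definition sigma2 : elt K := (inj K1 0, inj K1 1).

(* The point [(a + b * sqrt 5, sqrt 3 * (c + d * sqrt 5))]. *)
Definition plane (a b c d : Z) : cpx K :=
  (((((a, b), (0, 0)), inj Q53 0), inj K1 0),
   ((((0, 0), (c, d)), inj Q53 0), inj K1 0))%Z.

Definition ctimes (z : Z) (p : cpx K) : cpx K :=
  (mul (inj K z) p.1, mul (inj K z) p.2).

(* The kite scaled by 8, in the order: apex of the unit triangle, the other two
   apexes, the 1, 2, 2 triangle, the midpoints of the two triangles of side 2. *)
Definition kite : seq (cpx K) :=
  [:: plane 0 0 (-4) 0; plane (-2) (-6) 2 2; plane 2 6 2 2;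
      plane (-4) 0 0 0; plane 4 0 0 0; plane 0 0 0 4;
      plane (-2) 0 0 2; plane (-3) (-3) 1 1; plane (-1) (-3) 1 3;
      plane 2 0 0 2; plane 3 3 1 1; plane 1 3 1 3]%Z.

(* The brace without its ends, moved by a similarity that sends the ends to 0
   and 1, scaled by 1056 = 8 * 132.  With d the vector joining the ends of the
   original brace, [plane 3 (-9) 33 (-11)] is [132 / d].  The mirror line becomes
   the line of abscissa 1/2. *)
Definition unit_brace : seq (cpx K) :=
  let half := [seq cmul (csub z (plane 2 6 2 2)) (plane 3 (-9) 33 (-11))
              | z <- take 2 kite ++ drop 3 kite] in
  half ++ [seq (add (inj K 1056) (opp z.1), z.2) | z <- drop 2 half].

Definition brace (p q : cpx K) : seq (cpx K) :=
  [seq cadd (ctimes 1056 p) (cmul z (csub q p)) | z <- unit_brace].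

(* With [s = den * sqrt (L^2 / |b - a|^2 - 1/4)], the apex of the isosceles
   triangle over [a, b] with legs L, to the left of the direction from [a] to
   [b], scaled by [2 * den]. *)
Definition joint (den : Z) (s : elt K) (a b : cpx K) : cpx K :=
  let d := csub b a in
  cadd (ctimes den (cadd a b)) (ctimes 2 (cmul (inj K 0, s) d)).

(* Vertices are scaled by [16896 * den = 8 * (2 * den) * 1056].  A brace from p to
   q bulges less on the left of the direction from p to q; both braces of a pair
   have that side inside their isosceles triangle. *)
Definition graph_vertices (den : Z) (core : seq (cpx K))
  (ab cd : nat * nat) : seq (cpx K) :=
  let at8 i := nth (inj K 0, inj K 0) core i in
  let at16 i := ctimes (2 * den) (at8 i) in
  let j1 := joint den sigma1 (at8 ab.1) (at8 ab.2) in
  let j2 := joint den sigma2 (at8 cd.1) (at8 cd.2) in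
  [seq ctimes 1056 p | p <- [seq ctimes (2 * den) p | p <- core] ++ [:: j1; j2]]
  ++ brace (at16 ab.2) j1 ++ brace j1 (at16 ab.1)
  ++ brace (at16 cd.2) j2 ++ brace j2 (at16 cd.1).

Definition strip (k : nat) (x y h : Z) : seq (cpx K) :=
  [seq (plane (x + 4 * Z.of_nat i) 0 (y + (if odd i then 0 else h)) 0)%Z
  | i <- iota 0 k].

Definition grid_point (M : Z) (p : cpx K) : Z * Z :=
  let coord x := (grid * (encl x).1 / (scale K * M))%Z in
  (coord p.1, coord p.2).

End Graph.

Definition kite_edges : seq (nat * nat) :=
  [:: (0, 3); (0, 4); (3, 4); (3, 6); (6, 5); (3, 7); (7, 1); (1, 8); (8, 5);
      (6, 7); (7, 8); (6, 8); (4, 9); (9, 5); (4, 10); (10, 2); (2, 11);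
      (11, 5); (9, 10); (10, 11); (9, 11)].

(* The vertices of the brace other than its ends p and q are numbered from o
   on, the first two being those common to both kites. *)
Definition brace_edges (p q o : nat) : seq (nat * nat) :=
  let left k := if k == 2 then p else if (k < 2)%N then o + k else o + k - 1 in
  let right k := if k == 2 then q else if (k < 2)%N then o + k else o + k + 8 in
  [seq (left e.1, left e.2) | e <- kite_edges] ++
  [seq (right e.1, right e.2) | e <- kite_edges].

Definition graph_edges (k : nat) (core : seq (nat * nat)) (ab cd : nat * nat) :=
  core ++ brace_edges ab.2 k (k + 2) ++ brace_edges k ab.1 (k + 22)
  ++ brace_edges cd.2 k.+1 (k + 42) ++ brace_edges k.+1 cd.1 (k + 62).

Definition strip_edges (o k : nat) : seq (nat * nat) :=
  [seq (i, i.+1) | i <- iota o (k - 1)] ++ [seq (i, i.+2) | i <- iota o (k - 2)].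

(** * The graphs with 94, 95 and 96 vertices *)

(* In each of the three graphs the two radicands are
   [den ^ 2 * (L^2 / |b - a|^2 - 1/4)] for the two spanned pairs [a, b]. *)

Lemma root94a : root_test (ofQ5 221958 95418) (10 ^ 8) 65978718862 = true.
Proof. by vm_compute. Qed.

Lemma root94b : root_test ((ofQ5 91428 42408, inj Q53 0) : elt (quadRing root94a))
  (10 ^ 8) 43157290321 = true.
Proof. by vm_compute. Qed.

Definition K94 : numRing := quadRing root94b.

Definition scale94 : Z := 16896 * 228.

(** The pair [(0, 4)] runs rightwards and [(11, 5)] leftwards, which puts one joint above the core
    and the other below it. *)
Definition vertices94 : seq (cpx K94) := Eval vm_compute in
  graph_vertices 228 (strip root94b 5 (-8) 4 4 ++ strip root94b 7 (-12) 0 (-4)) (0, 4) (11, 5).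

Definition edges94 : seq (nat * nat) := Eval vm_compute in
  graph_edges 12 (strip_edges 0 5 ++ strip_edges 5 7 ++ [:: (1, 6); (3, 10)]) (0, 4) (11, 5).

Definition grid_points94 : seq (Z * Z) := Eval vm_compute in
  [seq grid_point (H2 := root94b) scale94 p | p <- vertices94].

Lemma graph94 : exists (e : rel 'I_94) (pos : 'I_94 -> point),
  matchstick_graph e pos /\ four_regular e.
Proof.
apply: (@matchstick_drawing K94 scale94 erefl 94 vertices94 grid_points94 edges94);
  by vm_compute.
Qed.

Lemma root95a : root_test (ofQ5 783275 360468) (10 ^ 8) 126067678320 = true.
Proof. by vm_compute. Qed.

Lemma root95b : root_test ((ofQ5 870179 291312, inj Q53 0) : elt (quadRing root95a))
  (10 ^ 8) 123352034221 = true.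
Proof. by vm_compute. Qed.

Definition K95 : numRing := quadRing root95b.

Definition scale95 : Z := 16896 * 646.

(** The added point 12 completes a rhombus with the points 8, 6, 5 of the kite. *)
Definition vertices95 : seq (cpx K95) := Eval vm_compute in
  graph_vertices 646 (rcons (kite root95b) (plane root95b 1 (-3) 1 5)) (12, 2) (0, 1).

Definition edges95 : seq (nat * nat) := Eval vm_compute in
  graph_edges 13 (rem (8, 5) kite_edges ++ [:: (8, 12); (5, 12)]) (12, 2) (0, 1).

Definition grid_points95 : seq (Z * Z) := Eval vm_compute in
  [seq grid_point (H2 := root95b) scale95 p | p <- vertices95].

Lemma graph95 : exists (e : rel 'I_95) (pos : 'I_95 -> point),
  matchstick_graph e pos /\ four_regular e.
Proof.
apply: (@matchstick_drawing K95 scale95 erefl 95 vertices95 grid_points95 edges95);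
  by vm_compute.
Qed.

Lemma root96a : root_test (ofQ5 22857 10602) (10 ^ 8) 21578645160 = true.
Proof. by vm_compute. Qed.

Lemma root96b : root_test ((ofQ5 22857 10602, inj Q53 0) : elt (quadRing root96a))
  (10 ^ 8) 21578645160 = true.
Proof. by vm_compute. Qed.

Definition K96 : numRing := quadRing root96b.

Definition scale96 : Z := 16896 * 114.

Definition vertices96 : seq (cpx K96) := Eval vm_compute in
  graph_vertices 114 (strip root96b 7 (-8) 4 4 ++ strip root96b 7 (-12) 0 (-4)) (0, 6) (13, 7).

Definition edges96 : seq (nat * nat) := Eval vm_compute in
  graph_edges 14 (strip_edges 0 7 ++ strip_edges 7 7 ++ [:: (1, 8); (5, 12)]) (0, 6) (13, 7).

Definition grid_points96 : seq (Z * Z) := Eval vm_compute in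
  [seq grid_point (H2 := root96b) scale96 p | p <- vertices96].

Lemma graph96 : exists (e : rel 'I_96) (pos : 'I_96 -> point),
  matchstick_graph e pos /\ four_regular e.
Proof.
apply: (@matchstick_drawing K96 scale96 erefl 96 vertices96 grid_points96 edges96);
  by vm_compute.
Qed.

Theorem theorem5p1 :
  forall n : nat, n = 94 \/ n = 95 \/ n = 96 ->
  exists (e : rel 'I_n) (pos : 'I_n -> point),
    matchstick_graph e pos /\ four_regular e.
Proof.
by move=> n [-> | [-> | ->]]; [exact: graph94 | exact: graph95 | exact: graph96].
Qed.
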